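(* The space $\mathcal P_\infty$ of proper poset limits is a contractible topological space; in particular it is connected and simply connected.
   Context: A poset is a nonempty set with a strict partial order $<$. For finite posets $Q,P$, $t(Q,P)$ is the proportion of all maps $\varphi$ from the ground set of $Q$ to that of $P$ with $x<_Qy\Rightarrow\varphi(x)<_P\varphi(y)$. Let $\mathcal P$ be the set of isomorphism classes of finite nonempty posets; identify $\mathcal P$ with its (injective) image under $P\mapsto((t(Q,P))_{Q\in\mathcal P},|P|^{-1})\in[0,1]^{\mathcal P}\times[0,1]$, let $\overline{\mathcal P}$ be its closure in the product topology, and let $\mathcal P_\infty=\overline{\mathcal P}\setminus\mathcal P$ with the subspace topology (a compact metrizable space). *)

(* Defs.v *)
From HB Require Import structures.
From mathcomp Require Import all_boot all_order all_algebra.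
From mathcomp Require Import all_classical all_reals topology normedtype.
Unset Printing Implicit Defensive.
Import Order.TTheory GRing.Theory Num.Theory.
Import numFieldNormedType.Exports.
Local Open Scope classical_set_scope.
Local Open Scope ring_scope.

Record fposet := FPoset {
  pn : nat;
  pn_gt0 : (0 < pn)%N;
  prel : rel 'I_pn;
  prel_irr : irreflexive prel;
  prel_trans : transitive prel }.

Definition hom_count (Q P : fposet) : nat :=
  #|[set f : {ffun 'I_(pn Q) -> 'I_(pn P)} |
      [forall x, forall y, prel Q x y ==> prel P (f x) (f y)]]|.

Definition tdens (R : realType) (Q P : fposet) : R :=
  (hom_count Q P)%:R / ((pn P) ^ (pn Q))%:R.

Notation ambient R := ({ptws fposet -> R} * R)%type.

Definition emb (R : realType) (P : fposet) : ambient R :=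
  ((fun Q : fposet => tdens R Q P) : {ptws fposet -> R}, (pn P)%:R^-1).

Definition Pbar (R : realType) : set (ambient R) := closure (range (emb R)).
Definition Pinf (R : realType) : set (ambient R) := Pbar R `\` range (emb R).

Definition I01 (R : realType) : set R := [set` `[0%R, 1%R]%R].

Definition contractible (R : realType) {T : topologicalType} (A : set T) :=
  exists x0 : T, A x0 /\
  exists H : T * R -> T,
    {within A `*` (I01 R), continuous H} /\
    (forall x s, A x -> (I01 R) s -> A (H (x, s))) /\
    (forall x, A x -> H (x, 0) = x) /\
    (forall x, A x -> H (x, 1) = x0).

Definition path_connected (R : realType) {T : topologicalType} (A : set T) :=
  forall x y, A x -> A y ->
  exists g : R -> T, {within (I01 R), continuous g} /\
    (forall s, (I01 R) s -> A (g s)) /\ g 0 = x /\ g 1 = y.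

Definition simply_connected (R : realType) {T : topologicalType} (A : set T) :=
  path_connected R A /\
  forall g : R -> T, {within (I01 R), continuous g} ->
    (forall s, (I01 R) s -> A (g s)) -> g 0 = g 1 ->
    exists H : R * R -> T,
      {within (I01 R) `*` (I01 R), continuous H} /\
      (forall s t, (I01 R) s -> (I01 R) t -> A (H (s, t))) /\
      (forall s, (I01 R) s -> H (s, 0) = g s) /\
      (forall s, (I01 R) s -> H (s, 1) = g 0) /\
      (forall t, (I01 R) t -> H (0, t) = g 0 /\ H (1, t) = g 0).

(* Main.v *)
Require Import Defs.
From HB Require Import structures.
From mathcomp Require Import all_boot all_order all_algebra.
From mathcomp Require Import all_classical all_reals topology normedtype.
From mathcomp Require Import lra.
Import Order.TTheory GRing.Theory Num.Theory.
Import numFieldNormedType.Exports.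
Local Open Scope classical_set_scope.
Local Open Scope ring_scope.

(* Write m(Q) for the number of non-isolated points of Q. Adding k isolated
   points to an n-point poset P multiplies each density t(Q, P) by exactly
   (n / (n + k)) ^ m(Q), because non-isolated points of Q can only be sent to P
   while isolated ones go anywhere. Passing to the limit, for 0 <= a <= 1 the
   map (t(Q))_Q |-> (a ^ m(Q) t(Q))_Q preserves the proper limits, which are the
   points of the closure with inverse size 0: only finitely many posets have a
   size below a given bound. Moving a from 1 to 0 contracts the space to the
   limit of antichains. *)

(** * Continuity into products and pasting of continuous maps *)

Lemma continuous_ptws_eval (I : Type) (T : topologicalType) (i : I) :
  continuous (fun f : {ptws I -> T} => f i).
Proof.
move=> f; have /cvg_sup/(_ i) cf : nbhs (f : {ptws I -> T}) --> f by exact: cvg_id.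
move=> U /(@initial_continuous _ _ (fun f : I -> T => f i) f); exact: cf.
Qed.

Lemma continuous_ptws (X : topologicalType) (I : Type) (T : topologicalType)
    (f : X -> {ptws I -> T}) :
  (forall i, continuous (fun x => f x i)) -> continuous f.
Proof.
move=> cf x; apply/cvg_sup => i.
exact: (@continuous_comp_initial (I -> T) X T (fun g => g i) f (cf i) x).
Qed.

Lemma continuous_pair (X Y Z : topologicalType) (f : X -> Y) (g : X -> Z) :
  continuous f -> continuous g -> continuous (fun x => (f x, g x)).
Proof. by move=> cf cg x; apply: cvg_pair; [exact: cf|exact: cg]. Qed.

(** Trades relative continuity for plain continuity: since [g] lands in [A], neighbourhoods within
    [A] pull back to neighbourhoods in [X]. *)
Lemma continuous_within_comp (X Y Z : topologicalType) (A : set Y)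
    (f : Y -> Z) (g : X -> Y) :
  {within A, continuous f} -> continuous g -> (forall x, A (g x)) ->
  continuous (f \o g).
Proof.
move=> /subspace_continuousP cf cg Ag x; apply: (cvg_comp _ _ _ (cf _ (Ag x))).
move=> U AU; have := cg x _ AU.
by apply: (@filterS _ (nbhs x)) => y /(_ (Ag y)).
Qed.

Lemma closure_continuous_image (X Y : topologicalType) (f : X -> Y)
    (D : set X) (E : set Y) (x : X) :
  continuous f -> (forall y, D y -> E (f y)) -> closure D x -> closure E (f x).
Proof.
move=> cf DE Dx U /cf /Dx [y [Dy Uy]].
by exists (f y); split => //; exact: DE.
Qed.

(** Pasting along the closed sets [c x <= b] and [b <= c x], which cover [X] and overlap exactly
    where the two maps are assumed to agree. *)
Lemma continuous_glue (R : realType) (X Y : topologicalType) (c : X -> R)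
    (b : R) (f g : X -> Y) :
  continuous c -> continuous f -> continuous g ->
  (forall x, c x = b -> f x = g x) ->
  continuous (fun x => if c x <= b then f x else g x).
Proof.
move=> cc cf cg fg.
have cl1 : closed [set x | c x <= b].
  apply: (@preimage_closed _ _ c [set y | y <= b]); last exact: closed_le.
  by move=> x _; exact: cc.
have cl2 : closed [set x | b <= c x].
  apply: (@preimage_closed _ _ c [set y | b <= y]); last exact: closed_ge.
  by move=> x _; exact: cc.
have /withinU_continuous : {within [set x | c x <= b],
    continuous (fun x => if c x <= b then f x else g x)}.
  apply: (@subspace_eq_continuous _ _ _ f); last exact: continuous_subspaceT.
  by move=> x /set_mem /= cb; rewrite /from_subspace cb.
move=> /(_ _ cl1 cl2).
have -> : [set x | c x <= b] `|` [set x | b <= c x] = setT.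
  by apply/seteqP; split => // x _; case: (lerP (c x) b) => h; [left|right; exact: ltW].
move=> h; apply/continuous_subspace_setT; apply: h.
apply: (@subspace_eq_continuous _ _ _ g); last exact: continuous_subspaceT.
move=> x /set_mem /= bc; rewrite /from_subspace; case: ifP => // cb.
apply/esym/fg.
by apply/eqP; rewrite eq_le cb.
Qed.

(** The retraction of the line onto the unit interval. It lets paths and homotopies be built as
    continuous maps on the whole line or plane. *)
Definition clamp01 (R : realType) (s : R) : R := Num.max 0 (Num.min s 1).

Lemma clamp01_I01 (R : realType) (s : R) : I01 R (clamp01 R s).
Proof.
by rewrite /I01 /clamp01 /= in_itv /= le_max lexx ge_max ler01 ge_min lexx orbT.
Qed.

Lemma clamp01_id (R : realType) (s : R) : I01 R s -> clamp01 R s = s.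
Proof.
by rewrite /I01 /clamp01 /= in_itv /= => /andP[s0 s1]; rewrite min_l ?max_r.
Qed.

Lemma clamp01_le0 (R : realType) (s : R) : s <= 0 -> clamp01 R s = 0.
Proof. by move=> s0; rewrite /clamp01 max_l // ge_min s0. Qed.

Lemma clamp01_ge1 (R : realType) (s : R) : 1 <= s -> clamp01 R s = 1.
Proof. by move=> s1; rewrite /clamp01 min_r // max_r // ler01. Qed.

Lemma continuous_clamp01 (R : realType) (X : topologicalType) (c : X -> R) :
  continuous c -> continuous (fun x => clamp01 R (c x)).
Proof.
move=> cc x; apply: (@continuous_max _ _ (cst 0) (fun x => Num.min (c x) 1)).
  exact: cst_continuous.
apply: (@continuous_min _ _ c (cst 1)); first exact: cc.
exact: cst_continuous.
Qed.

Lemma I01_0 (R : realType) : I01 R 0.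
Proof. by rewrite /I01 /= in_itv /= lexx ler01. Qed.

Lemma I01_1 (R : realType) : I01 R 1.
Proof. by rewrite /I01 /= in_itv /= lexx ler01. Qed.

(** * Connectedness and simple connectedness from contractibility *)

Section contractible_consequences.
Context {R : realType} {T : topologicalType}.
Implicit Types (A : set T) (X : topologicalType).

Lemma continuous_contraction A (H : T * R -> T) X (f : X -> T) (c : X -> R) :
  {within A `*` I01 R, continuous H} -> continuous f -> (forall x, A (f x)) ->
  continuous c -> continuous (fun x => H (f x, clamp01 R (c x))).
Proof.
move=> cH cf Af cc.
apply: (@continuous_within_comp _ _ _ (A `*` I01 R) H) => // [|x].
  by apply: continuous_pair => //; exact: continuous_clamp01.
by split; [exact: Af|exact: clamp01_I01].
Qed.

Lemma contractible_path_connected A : contractible R A -> path_connected R A.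
Proof.
move=> [x0 [Ax0 [H [cH [AH [H0 H1]]]]]] x y Ax Ay.
pose f z (c : R -> R) (t : R) := H (z, clamp01 R (c t)).
have cf z c : A z -> continuous c -> continuous (f z c).
  by move=> Az cc; apply: continuous_contraction cH _ _ cc => // t; exact: cvg_cst.
(* Follow the track of [x] to [x0], then the track of [y] backwards; at the midpoint both have
   parameter 1 and so both sit at [x0]. *)
exists (fun t : R => if t <= 2^-1 then f x (fun t => t * 2) t
                 else f y (fun t => 2 - t * 2) t).
split; [|split; [|split]].
- apply/continuous_subspaceT/continuous_glue; first by move=> t; exact: cvg_id.
  + by apply: cf => // t; apply: cvgM; [exact: cvg_id|exact: cvg_cst].
  + apply: cf => // t; apply: cvgB; first exact: cvg_cst.
    by apply: cvgM; [exact: cvg_id|exact: cvg_cst].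
  + by move=> t ->; rewrite /f !clamp01_ge1 ?H1 //; lra.
- move=> s _; rewrite /f; case: ifP => _; apply: AH => //; exact: clamp01_I01.
- by rewrite ifT ?invr_ge0 ?ler0n// /f clamp01_le0 ?H0//; lra.
- by rewrite ifF /f; [rewrite clamp01_le0 ?H0//; lra|apply/negbTE; lra].
Qed.

(** [A] is the union of its connected subsets through a fixed point [a], because the image of a path
    from [a] to [y] is one containing [y]. *)
Lemma path_connected_connected A : path_connected R A -> connected A.
Proof.
move=> pA; have [->|/set0P[a Aa]] := eqVneq A set0.
  by move=> B [b Bb] [C _ BC]; move: Bb; rewrite BC set0I.
have -> : A = \bigcup_(B in [set B | B a /\ connected B /\ B `<=` A]) B.
  apply/seteqP; split => [y Ay|y [B [_ [_ BA]]]]; last exact: BA.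
  have [g [cg [Ag [g0 g1]]]] := pA _ _ Aa Ay.
  exists (g @` I01 R); last by exists 1 => //; exact: I01_1.
  split; [by exists 0 => //; exact: I01_0|split]; last first.
    by move=> _ [s s01 <-]; exact: Ag.
  by apply: connected_continuous_connected cg; exact: segment_connected.
apply: bigcup_connected; first by exists a => B [].
by move=> B [_ []].
Qed.

(* [(s, u) |-> ((1 - u) s + u clamp (3 s - 1), u clamp (min (3 s) (3 - 3 s)))]
   pushes the bottom edge of the square, relative to its end points, onto the
   path going up the left edge, across the top edge and down the right edge.
   The contraction [H] is constant on the top edge, so the image of the loop
   becomes a path followed by its inverse, which retracts to its origin. *)
Lemma contractible_simply_connected A :
  contractible R A -> simply_connected R A.
Proof.
move=> cA; split; first exact: contractible_path_connected.
case: cA => [x0 [Ax0 [H [cH [AH [H0 H1]]]]]] g cg Ag g01.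
pose across (s : R) := clamp01 R (s * 3 - 1).
pose height (s : R) := clamp01 R (Num.min (s * 3) (3 - s * 3)).
pose u (z : R * R) := clamp01 R (z.2 * 2).
pose al (z : R * R) := (1 - u z) * z.1 + u z * across z.1.
pose F (z : R * R) := H (g (clamp01 R (al z)), clamp01 R (u z * height z.1)).
pose B (z : R * R) := H (g 0, clamp01 R ((2 - z.2 * 2) * height z.1)).
have c1 : continuous (fun z : R * R => z.1 : R) by move=> z; exact: cvg_fst.
have c2 : continuous (fun z : R * R => z.2 : R) by move=> z; exact: cvg_snd.
have ck k : continuous (fun z : R * R => k : R) by move=> z; exact: cvg_cst.
have cD (f h : R * R -> R) : continuous f -> continuous h ->
    continuous (fun z => f z + h z).
  by move=> cf ch z; apply: cvgD; [exact: cf|exact: ch].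
have cN (f : R * R -> R) : continuous f -> continuous (fun z => - f z).
  by move=> cf z; apply: cvgN; exact: cf.
have cM (f h : R * R -> R) : continuous f -> continuous h ->
    continuous (fun z => f z * h z).
  by move=> cf ch z; apply: cvgM; [exact: cf|exact: ch].
have cu : continuous u by apply: continuous_clamp01; exact: cM.
have cacross : continuous (fun z : R * R => across z.1).
  by apply: continuous_clamp01; apply: cD => //; exact: cM.
have cheight : continuous (fun z : R * R => height z.1).
  apply: continuous_clamp01 => z.
  apply: (@continuous_min _ _ (fun z : R * R => z.1 * 3)
                              (fun z : R * R => 3 - z.1 * 3)).
    exact: (cM _ _ c1 (ck 3) z).
  exact: (cD _ _ (ck 3) (cN _ (cM _ _ c1 (ck 3))) z).
have cal : continuous al.
  exact: cD _ _ (cM _ _ (cD _ _ (ck 1) (cN _ cu)) c1) (cM _ _ cu cacross).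
have Ag0 : A (g 0) by apply: Ag; exact: I01_0.
have cF : continuous F.
  apply: continuous_contraction cH _ _ _.
  - apply: (@continuous_within_comp _ _ _ (I01 R) g) => //.
      exact: continuous_clamp01.
    by move=> z; exact: clamp01_I01.
  - by move=> z; apply: Ag; exact: clamp01_I01.
  - exact: cM.
have cB : continuous B.
  apply: continuous_contraction cH _ _ _ => //.
  - by move=> z; exact: cvg_cst.
  - exact: cM _ _ (cD _ _ (ck 2) (cN _ (cM _ _ c2 (ck 2)))) cheight.
have height0 s : s <= 0 -> height s = 0.
  by move=> s0; apply: clamp01_le0; rewrite ge_min; apply/orP; left; lra.
have height1 s : 1 <= s -> height s = 0.
  by move=> s0; apply: clamp01_le0; rewrite ge_min; apply/orP; right; lra.
have HA x s : A x -> A (H (x, clamp01 R s)).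
  by move=> Ax; apply: AH => //; exact: clamp01_I01.
exists (fun z => if z.2 <= 2^-1 then F z else B z); split; [|split; [|split; [|split]]].
- apply/continuous_subspaceT/continuous_glue => // -[s t] /= ->.
  rewrite /F /B /al /u /= (@clamp01_ge1 _ (2^-1 * 2)); last by lra.
  rewrite (_ : 2 - 2^-1 * 2 = 1); last by lra.
  rewrite subrr mul0r add0r !mul1r.
  (* On the seam, [F] starts from [g (across s)] and [B] from [g 0], at the same height. In the
     outer thirds [across s] is 0 or 1, where [g] takes the same value; in the middle third the
     height is 1 and both are [x0]. *)
  have [s13|s13] := lerP s (3^-1).
    by rewrite /across (@clamp01_le0 _ (s * 3 - 1)) ?(@clamp01_le0 _ 0)//; lra.
  have [s23|s23] := lerP (2 / 3) s.
    by rewrite /across (@clamp01_ge1 _ (s * 3 - 1)) ?(@clamp01_ge1 _ 1) ?g01//; lra.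
  have -> : height s = 1 by apply: clamp01_ge1; rewrite le_min; apply/andP; split; lra.
  by rewrite (@clamp01_ge1 _ 1) // !H1 //; apply: Ag; exact: clamp01_I01.
- move=> s t _ _ /=; case: ifP => _; last exact: HA.
  by apply: HA; apply: Ag; exact: clamp01_I01.
- move=> s s01 /=; rewrite ifT ?invr_ge0 ?ler0n// /F /al /u /=.
  rewrite mul0r (@clamp01_le0 _ 0)// subr0 mul1r !mul0r addr0.
  by rewrite (@clamp01_le0 _ 0)// clamp01_id// H0//; exact: Ag.
- move=> s s01 /=; rewrite ifF; last by apply/negbTE; lra.
  rewrite /B /= (_ : 2 - 1 * 2 = 0); last by lra.
  by rewrite mul0r clamp01_le0// H0.
(* On the vertical sides the height vanishes and [al] stays at 0 or 1, so only the end points of the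
   loop occur. *)
- move=> t _ /=; rewrite /F /B /al /= height0// height1// !mulr0.
  rewrite (@clamp01_le0 _ 0)// !H0//; last 2 first.
  + by apply: Ag; exact: clamp01_I01.
  + by apply: Ag; exact: clamp01_I01.
  rewrite add0r /across (@clamp01_le0 _ (0 * 3 - 1)); last by lra.
  rewrite (@clamp01_ge1 _ (1 * 3 - 1)); last by lra.
  rewrite mulr0 !mulr1 subrK (@clamp01_le0 _ 0)// (@clamp01_ge1 _ 1)// -g01.
  by split; case: ifP.
Qed.

End contractible_consequences.

(** * Homomorphism counts and isolated points *)

Definition nonisolated (Q : fposet) : pred 'I_(pn Q) :=
  [pred x | [exists y, prel Q x y || prel Q y x]].

Definition num_nonisolated (Q : fposet) : nat := #|{: {x | nonisolated Q x}}|.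

Lemma num_nonisolated_le (Q : fposet) : (num_nonisolated Q <= pn Q)%N.
Proof. by rewrite /num_nonisolated card_sig -[leqRHS]card_ord max_card. Qed.

Definition homs (Q : fposet) (T : finType) (r : rel T) :
    pred {ffun 'I_(pn Q) -> T} :=
  [pred f : {ffun 'I_(pn Q) -> T} | [forall x, forall y, prel Q x y ==> r (f x) (f y)]].

Definition core_homs (Q : fposet) (T : finType) (r : rel T) :
    pred {ffun {x | nonisolated Q x} -> T} :=
  [pred f : {ffun {x | nonisolated Q x} -> T} |
    [forall x, forall y, prel Q (val x) (val y) ==> r (f x) (f y)]].

(** Passes from the classical set inside [hom_count] to a boolean predicate. *)
Lemma hom_countE (Q P : fposet) : hom_count Q P = #|homs Q 'I_(pn P) (prel P)|.
Proof. by apply: eq_card => f; apply/idP/idP => [/set_mem|/mem_set]. Qed.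

(** Every relation of [Q] joins two non-isolated points, so a homomorphism is a homomorphism on
    those points together with arbitrary values on the isolated ones. *)
Lemma card_homs (Q : fposet) (T : finType) (r : rel T) :
  #|homs Q T r| =
  (#|core_homs Q T r| * #|T| ^ (pn Q - num_nonisolated Q))%N.
Proof.
pose S := {x | nonisolated Q x}; pose I := {x | ~~ nonisolated Q x}.
have cI : #|{: I}| = (pn Q - num_nonisolated Q)%N.
  rewrite /num_nonisolated !card_sig.
  apply/eqP; rewrite -(eqn_add2l #|[pred x | nonisolated Q x]|) subnKC.
    by rewrite -[X in _ == X]card_ord -(cardC [pred x | nonisolated Q x]).
  by rewrite -[leqRHS]card_ord max_card.
pose phi (f : {ffun 'I_(pn Q) -> T}) : {ffun S -> T} * {ffun I -> T} :=
  ([ffun x => f (val x)], [ffun x => f (val x)]).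
have phi_inj : injective phi.
  move=> f g [/ffunP fg1 /ffunP fg2]; apply/ffunP => x.
  have [Sx|Ix] := boolP (nonisolated Q x).
    by have := fg1 (exist _ x Sx); rewrite !ffunE.
  by have := fg2 (exist _ x Ix); rewrite !ffunE.
rewrite -cI -card_ffun -cardX -(card_imset _ phi_inj).
apply: eq_card => -[a b]; rewrite !inE andbT.
apply/imsetP/idP => [[f]|].
  rewrite inE => /'forall_forallP hf [-> _].
  by apply/'forall_forallP => x y; rewrite !ffunE; exact: hf.
move=> /'forall_forallP ha.
(* The preimage of [(a, b)] under the restriction map [phi]. *)
pose f := [ffun x => match pselect (nonisolated Q x) with
                     | left Sx => a (exist _ x Sx)
                     | right Ix => b (exist _ x (introN idP Ix))
                     end].
have fS (x : S) : f (val x) = a x.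
  rewrite ffunE; case: pselect => [Sx|[]]; last exact: valP.
  by congr (a _); exact: val_inj.
have fI (x : I) : f (val x) = b x.
  rewrite ffunE; case: pselect => [Sx|Ix]; last by congr (b _); exact: val_inj.
  by have /negP := valP x.
exists f.
  rewrite inE; apply/'forall_forallP => x y; apply/implyP => xy.
  have Sx : nonisolated Q x by apply/existsP; exists y; rewrite xy.
  have Sy : nonisolated Q y by apply/existsP; exists x; rewrite xy orbT.
  by have := implyP (ha (exist _ x Sx) (exist _ y Sy)) xy; rewrite -!fS.
by congr pair; apply/ffunP => x; rewrite ffunE ?fS ?fI.
Qed.

(** * Adding isolated points to a poset *)

Definition add_antichain_rel (P : fposet) (k : nat) : rel 'I_(pn P + k) :=
  fun i j => match fintype.split i, fintype.split j with
             | inl a, inl b => prel P a b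
             | _, _ => false
             end.

Lemma add_antichain_irr P k : irreflexive (add_antichain_rel P k).
Proof.
by move=> i; rewrite /add_antichain_rel; case: (fintype.split i) => // a; exact: prel_irr.
Qed.

Lemma add_antichain_trans P k : transitive (add_antichain_rel P k).
Proof.
move=> j i l; rewrite /add_antichain_rel.
case: (fintype.split i) => // a; case: (fintype.split j) => // b; case: (fintype.split l) => // c.
exact: prel_trans.
Qed.

Definition add_antichain (P : fposet) (k : nat) : fposet :=
  FPoset (pn P + k) (ltn_addr k (pn_gt0 P)) (add_antichain_rel P k)
    (add_antichain_irr P k) (add_antichain_trans P k).

(** A non-isolated point is comparable to another, so its image is too, and hence avoids the [k] new
    points. *)
Lemma card_core_homs_add_antichain (Q P : fposet) (k : nat) :
  #|core_homs Q 'I_(pn P + k) (add_antichain_rel P k)| =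
  #|core_homs Q 'I_(pn P) (prel P)|.
Proof.
pose S := {x | nonisolated Q x}.
pose phi (f : {ffun S -> 'I_(pn P)}) : {ffun S -> 'I_(pn P + k)} :=
  [ffun x => lshift k (f x)].
have phi_inj : injective phi.
  move=> f g /ffunP fg; apply/ffunP => x; have := fg x; rewrite !ffunE.
  exact: lshift_inj.
rewrite -(card_imset _ phi_inj); apply: eq_card => f.
apply/idP/imsetP => [|[g]]; last first.
  rewrite !inE => /'forall_forallP hg ->; apply/'forall_forallP => x y.
  rewrite !ffunE /add_antichain_rel.
  by rewrite !(unsplitK (inl _ : 'I_(pn P) + 'I_k)%type); exact: hg.
rewrite inE => /'forall_forallP hf.
have lf (x : S) : {a | f x = lshift k a}.
  apply: cid; have /existsP[y /orP[xy|yx]] := valP x.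
  - have Sy : nonisolated Q y by apply/existsP; exists (val x); rewrite xy orbT.
    have := implyP (hf x (exist _ y Sy)) xy; rewrite /add_antichain_rel.
    by case: (split_ordP (f x)) => // a -> _; exists a.
  - have Sy : nonisolated Q y by apply/existsP; exists (val x); rewrite yx.
    have := implyP (hf (exist _ y Sy) x) yx; rewrite /add_antichain_rel.
    case: (fintype.split _) => // c.
    by case: (split_ordP (f x)) => // a -> _; exists a.
exists [ffun x => sval (lf x)]; last first.
  by apply/ffunP => x; rewrite !ffunE; exact: (svalP (lf x)).
rewrite inE; apply/'forall_forallP => x y; rewrite !ffunE; apply/implyP => xy.
have := implyP (hf x y) xy; rewrite /add_antichain_rel.
rewrite {1}(svalP (lf x)) {1}(svalP (lf y)).
by rewrite !(unsplitK (inl _ : 'I_(pn P) + 'I_k)%type).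
Qed.

Lemma tdens_add_antichain (R : realType) (Q P : fposet) (k : nat) :
  tdens R Q (add_antichain P k) =
  ((pn P)%:R / (pn P + k)%:R) ^+ num_nonisolated Q * tdens R Q P.
Proof.
rewrite /tdens !hom_countE !card_homs /= card_core_homs_add_antichain !card_ord.
have := pn_gt0 P; have := num_nonisolated_le Q.
move: #|core_homs Q _ (prel P)| => h.
move: (num_nonisolated Q) (pn Q) (pn P) => m q n mq n0.
(* The free choices at the [q - m] isolated points cancel, leaving [m] powers of the target size;
   this is applied to sizes [n + k] and [n]. *)
have E l : (0 < l)%N -> (h * l ^ (q - m))%:R / (l ^ q)%:R = h%:R / l%:R ^+ m :> R.
  move=> l0; have lu : l%:R != 0 :> R by rewrite pnatr_eq0 -lt0n.
  rewrite -{2}(subnK mq) expnD !natrM !natrX invfM mulrA mulfK //.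
  by rewrite expf_neq0.
rewrite !E ?ltn_addr // expr_div_n [RHS]mulrC mulrA.
by rewrite mulfVK // expf_neq0 // pnatr_eq0 -lt0n.
Qed.

(** Serves the end of the contraction, where the factor [0 ^+ 0 = 1] leaves these densities
    unchanged. *)
Lemma tdens_num_nonisolated0 (R : realType) (Q P : fposet) :
  num_nonisolated Q = 0%N -> tdens R Q P = 1.
Proof.
move=> Q0; rewrite /tdens hom_countE card_homs Q0 subn0 card_ord.
suff -> : #|core_homs Q 'I_(pn P) (prel P)| = 1%N.
  by rewrite mul1n divff // pnatr_eq0 -lt0n expn_gt0 pn_gt0.
have S0 x : ~~ nonisolated Q x.
  by apply: (contraPN _ Q0) => Sx; apply/eqP; rewrite -lt0n; apply/card_gt0P; exists (exist _ x Sx).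
rewrite (eq_card (B := predT)) ?card_ffun ?/num_nonisolated ?Q0 ?expn0 //.
  by rewrite -/(num_nonisolated Q) Q0.
move=> f; rewrite !inE; apply/'forall_forallP => x.
by have := S0 (val x); rewrite (valP x).
Qed.

(** * Finiteness of the posets of bounded size *)

Definition poset_code (N : nat) (P : fposet) :
    'I_N.+1 * {ffun 'I_N.+1 * 'I_N.+1 -> bool} :=
  (inord (pn P),
   [ffun p => [exists i, exists j,
     [&& val i == val p.1, val j == val p.2 & prel P i j]]]).

(** The size and the matrix of the relation, padded to a size independent of [P], recover the data
    of the record; proof irrelevance settles its other fields. *)
Lemma poset_code_inj (N : nat) :
  {in [set P | (pn P <= N)%N] &, injective (poset_code N)}.
Proof.
move=> [n n0 r ri rt] [n' n'0 r' r'i r't] /set_mem /= nN /set_mem /= n'N.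
move=> /pair_equal_spec[/(congr1 val)/=]; rewrite !inordK ?ltnS // => nn'.
case: _ / nn' n'0 r' r'i r't n'N => n'0 r' r'i r't _ /ffunP E.
have rr' : r = r'.
  apply/funext => i; apply/funext => j.
  have := E (inord i, inord j); rewrite !ffunE /=.
  have inN (l : 'I_n) : (l < N.+1)%N by rewrite ltnS (leq_trans (ltnW (ltn_ord l))).
  have exE (s : rel 'I_n) : [exists i' : 'I_n, exists j' : 'I_n,
      [&& val i' == val (inord i : 'I_N.+1), val j' == val (inord j : 'I_N.+1) & s i' j']] = s i j.
    apply/existsP/idP => [[i' /existsP[j' /and3P[]]]|sij].
      by rewrite /= !inordK // => /eqP/val_inj -> /eqP/val_inj ->.
    by exists i; apply/existsP; exists j; rewrite /= !inordK // !eqxx.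
  by rewrite !exE.
subst r'; rewrite (Prop_irrelevance n0 n'0) (Prop_irrelevance ri r'i).
by rewrite (Prop_irrelevance rt r't).
Qed.


Lemma finite_small_posets (N : nat) : finite_set [set P | (pn P <= N)%N].
Proof.
rewrite -(eq_finite_set (inj_card_eq (poset_code_inj N))).
exact: finite_finset.
Qed.

(** * Proper limits as closure points of inverse size 0 *)

Lemma accessible_separated (R : realType) (X : topologicalType) :
  (forall x y : X, (forall c : X -> R, continuous c -> c x = c y) -> x = y) ->
  accessible_space X.
Proof.
move=> sep x y xy; apply: contrapT => nA; move/eqP: xy; apply.
apply: sep => c cc; apply: contrapT => cxy; apply: nA.
exists (c @^-1` (~` [set c y])); split; rewrite ?inE /=; [|exact: cxy|by apply].
apply: open_comp; first by move=> z _; exact: cc.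
by apply: closed_openC; apply: accessible_closed_set1; apply/hausdorff_accessible/Rhausdorff.
Qed.

Section poset_limits.
Variable R : realType.
Implicit Types x : ambient R.

Lemma continuous_ambient_eval (Q : fposet) :
  continuous (fun x : ambient R => x.1 Q).
Proof.
move=> x; apply: (@continuous_comp _ _ _ fst (fun f : {ptws fposet -> R} => f Q)).
  exact: cvg_fst.
exact: continuous_ptws_eval.
Qed.

(** The continuous real coordinates separate points. This makes finite sets closed. *)
Lemma ambient_accessible : accessible_space (ambient R).
Proof.
apply: (@accessible_separated R) => -[f a] [g b] fg; congr pair.
  by apply/funext => Q; exact: (fg (fun x => x.1 Q) (continuous_ambient_eval Q)).
by apply: (fg snd) => x; exact: cvg_snd.
Qed.

(** If [x.2] were nonzero, posets near [x] would have bounded size; they form a finite, hence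
    closed, set of points, so [x] would itself be a poset. *)
Lemma Pinf_inv_size0 x : Pinf R x -> x.2 = 0.
Proof.
move=> [xcl xr]; apply: contrapT => /eqP x20; apply: xr.
(* An inverse size within [|x.2| / 2] of [x.2] exceeds [|x.2| / 2], so the size is below [N]. *)
pose N := (Num.truncn (`|x.2| / 2)^-1).+1.
have h0 : 0 < `|x.2| / 2 by rewrite divr_gt0 ?normr_gt0.
suff : (emb R @` [set P | (pn P <= N)%N]) x by case=> P _ <-; exists P.
have /accessible_finite_set_closed cF := ambient_accessible.
apply: (cF _ (finite_image _ (finite_small_posets N))).
move=> U Ux.
have V : nbhs x [set y : ambient R | ball x.2 (`|x.2| / 2) y.2].
  by apply: (@cvg_snd _ _ (nbhs x.1) (nbhs x.2)); exact: nbhsx_ballx.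
have [_ [[P _ <-] [UP]]] := xcl _ (filterI Ux V).
rewrite /ball /= => xP; exists (emb R P); split => //; exists P => //=.
have : `|x.2| / 2 < (pn P)%:R^-1.
  have : `|x.2| <= `|x.2 - (pn P)%:R^-1| + `|(pn P)%:R^-1|.
    by rewrite -[X in `|X| <= _](subrK (pn P)%:R^-1) ler_normD.
  by rewrite [`|_^-1|]ger0_norm ?invr_ge0 //; lra.
have P0 : 0 < (pn P)%:R :> R by rewrite ltr0n pn_gt0.
rewrite -ltf_pV2 ?posrE ?invr_gt0 // invrK => PN.
rewrite -(ler_nat R); apply/ltW/(lt_trans PN).
exact: truncnS_gt.
Qed.

Lemma Pbar_inv_size0 x : Pbar R x -> x.2 = 0 -> Pinf R x.
Proof.
move=> xcl x0; split => // -[P _ Px]; move: x0; rewrite -Px /= => /eqP.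
by rewrite invr_eq0 pnatr_eq0 -leqn0 leqNgt pn_gt0.
Qed.

(** The equation holds at every poset and defines a closed set. *)
Lemma Pbar_num_nonisolated0 x Q : Pbar R x -> num_nonisolated Q = 0%N -> x.1 Q = 1.
Proof.
move=> xcl Q0.
have c1 : closed [set (1 : R)].
  by apply: accessible_closed_set1; apply/hausdorff_accessible/Rhausdorff.
apply: c1; apply: (closure_continuous_image _ _ (fun x : ambient R => x.1 Q) _ _ x _ _ xcl).
  exact: continuous_ambient_eval.
by move=> _ [P _ <-]; exact: tdens_num_nonisolated0.
Qed.

(* The point [thin (x, a, r)] of inverse size [r] is obtained from [x] by
   making each point isolated with probability [1 - a]. *)
Definition thin (z : ambient R * R * R) : ambient R :=
  ((fun Q => z.1.2 ^+ num_nonisolated Q * z.1.1.1 Q) : {ptws fposet -> R}, z.2).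

Lemma emb_add_antichain (P : fposet) (k : nat) :
  emb R (add_antichain P k) =
  thin (emb R P, (pn P)%:R / (pn P + k)%:R, (pn P + k)%:R^-1).
Proof.
by congr pair; apply/funext => Q; exact: tdens_add_antichain.
Qed.

Lemma continuous_thin : continuous thin.
Proof.
apply: continuous_pair; last by move=> z; exact: cvg_snd.
apply: continuous_ptws => Q z; apply: cvgM; last first.
  apply: (@continuous_comp _ _ _ (fun z : ambient R * R * R => z.1.1) (fun x : ambient R => x.1 Q));
    last exact: continuous_ambient_eval.
  by apply: (@continuous_comp _ _ _ fst fst); exact: cvg_fst.
apply: (@continuous_comp _ _ _ (fun z : ambient R * R * R => z.1.2) (fun a : R => a ^+ num_nonisolated Q)).
  by apply: (@continuous_comp _ _ _ fst snd); [exact: cvg_fst|exact: cvg_snd].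
elim: (num_nonisolated Q) => [|m IH]; first exact: cvg_cst.
rewrite (_ : (fun a : R => a ^+ m.+1) = (fun a => a * a ^+ m)).
  by apply: cvgM => //; exact: cvg_id.
by apply/funext => a; rewrite exprS.
Qed.

(** * Thinning of limits *)

Lemma ratio_approx (n : nat) (a e : R) : (0 < n)%N -> 0 <= a <= 1 ->
  n%:R^-1 < e -> exists k : nat, `|a - n%:R / (n + k)%:R| < e.
Proof.
move=> n0 /andP[a0 a1] ne.
have nR : 0 < n%:R :> R by rewrite ltr0n.
have e0 : 0 < e by apply: lt_trans ne; rewrite invr_gt0.
have nkR k : 0 < (n + k)%:R :> R by rewrite ltr0n ltn_addr.
have ex : exists k, n%:R / (n + k)%:R < a + e.
  exists (Num.truncn (n%:R / (a + e))).+1.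
  have ae : 0 < a + e by lra.
  rewrite ltr_pdivrMr // mulrC -ltr_pdivrMr //.
  apply: (lt_le_trans (truncnS_gt _)).
  by rewrite ler_nat leq_addl.
(* The ratios decrease from 1 in steps of at most [1 / n < e], so the first one below [a + e] is
   still above [a - e]. *)
have [k kae kmin] := ex_minnP ex.
exists k; rewrite ltr_norml; apply/andP; split; first by lra.
case: k kae kmin => [|k] kae kmin.
  by rewrite addn0 divff ?gt_eqF //; lra.
pose b : R := n%:R / (n + k)%:R; pose m : R := (n + k)%:R.
have aeb : a + e <= b.
  by rewrite leNgt; apply/negP => /kmin; rewrite ltnn.
set c := n%:R / (n + k.+1)%:R.
suff bc : b - c <= n%:R^-1 by move: b c aeb bc {kae kmin m} => b c; lra.
have bm : b * m = n%:R by rewrite /b /m mulfVK ?gt_eqF.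
have cm : c * m + c = n%:R.
  by rewrite -[X in _ + X]mulr1 -mulrDr natr1 -addnS /c mulfVK ?gt_eqF.
have c1 : c <= 1 by rewrite ler_pdivrMr // mul1r ler_nat leq_addr.
(* From [b * m = n = c * (m + 1)]. *)
have -> : b - c = c / m.
  have m0 : m != 0 by rewrite gt_eqF // nkR.
  by apply: (mulIf m0); rewrite mulfVK // mulrBl bm -cm addrAC subrr add0r.
rewrite (ler_pdivrMr _ _ (nkR k : 0 < m)); apply: (le_trans c1).
by rewrite mulrC ler_pdivlMr // mul1r ler_nat leq_addr.
Qed.

(** Triples that [thin] sends to genuine posets: the last entry is the inverse size after the points
    are added. *)
Definition thinned_posets : set (ambient R * R * R) :=
  [set (emb R P, (pn P)%:R / (pn P + k)%:R, (pn P + k)%:R^-1) |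
    P in [set: fposet] & k in [set: nat]].

Lemma thin_closure z : closure thinned_posets z -> Pbar R (thin z).
Proof.
apply: closure_continuous_image; first exact: continuous_thin.
by move=> _ [P _ [k _ <-]]; exists (add_antichain P k) => //; exact: emb_add_antichain.
Qed.

Lemma thin_Pinf x (a : R) : Pinf R x -> 0 <= a <= 1 -> Pinf R (thin (x, a, 0)).
Proof.
move=> xP a01; apply: Pbar_inv_size0 => //; apply: thin_closure.
have x20 := Pinf_inv_size0 _ xP; case: xP => xcl _.
move=> W [[W1 W2] /= [[[U V] /= [Ux Va] UV] W20] W12].
have /nbhs_ballP[e /= e0 eV] := Va; have /nbhs_ballP[d /= d0 dW] := W20.
(* A poset of inverse size below [e] has a ratio within [e] of [a]; being below [d] also controls
   the inverse size of the enlarged poset. *)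
pose m := Num.min e d.
have m0 : 0 < m by rewrite lt_min e0.
have small : nbhs x [set y : ambient R | ball x.2 m y.2].
  by apply: (@cvg_snd _ _ (nbhs x.1) (nbhs x.2)); exact: nbhsx_ballx.
have [_ [[P _ <-] [UP]]] := xcl _ (filterI Ux small).
rewrite x20 /ball /= sub0r normrN ger0_norm ?invr_ge0 // lt_min => /andP[Pe Pd].
have [k ak] := ratio_approx _ _ _ (pn_gt0 P) a01 Pe.
exists (emb R P, (pn P)%:R / (pn P + k)%:R, (pn P + k)%:R^-1); split.
  by exists P => //; exists k.
apply: W12; split => /=; first by apply: UV; split => //; exact: eV.
apply: dW; rewrite /ball /= sub0r normrN ger0_norm ?invr_ge0 //.
apply: le_lt_trans Pd; rewrite lef_pV2 ?posrE ?ltr0n ?ltn_addr ?pn_gt0 //.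
by rewrite ler_nat leq_addr.
Qed.

(** * The contraction to the limit of antichains *)

Definition antichain_limit : ambient R :=
  ((fun Q => (num_nonisolated Q == 0%N)%:R) : {ptws fposet -> R}, 0).

Lemma thin0 x : Pbar R x -> thin (x, 0, 0) = antichain_limit.
Proof.
move=> xcl; congr pair; apply/funext => Q /=.
have [Q0|Q0] := eqVneq (num_nonisolated Q) 0%N.
  by rewrite Q0 expr0 mul1r (Pbar_num_nonisolated0 _ _ xcl).
by rewrite expr0n (negbTE Q0) mul0r.
Qed.

Lemma thin1 x : x.2 = 0 -> thin (x, 1, 0) = x.
Proof.
case: x => f r /= ->; congr pair; apply/funext => Q /=.
by rewrite expr1n mul1r.
Qed.

Lemma Pinf_antichain_limit : Pinf R antichain_limit.
Proof.
(* Adding [k] points to the one-point poset gives the antichain on [1 + k] points; its ratio and its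
   inverse size are both [1 / (1 + k)], which tends to 0. *)
pose P := FPoset 1 isT (fun _ _ => false) (fun _ => erefl) (fun _ _ _ h _ => h).
have Pcl : Pbar R (emb R P) by apply: subset_closure; exists P.
apply: Pbar_inv_size0 => //; rewrite -(thin0 _ Pcl); apply: thin_closure.
move=> W [[W1 W2] /= [[[U V] /= [Ux Va] UV] W20] W12].
have /nbhs_ballP[e /= e0 eV] := Va; have /nbhs_ballP[d /= d0 dW] := W20.
pose k := Num.truncn (Num.min e d)^-1.
have m0 : 0 < Num.min e d by rewrite lt_min e0.
have : (1 + k)%:R^-1 < Num.min e d.
  by rewrite invf_plt ?posrE // add1n; exact: truncnS_gt.
rewrite lt_min => /andP[ke kd].
exists (emb R P, (pn P)%:R / (pn P + k)%:R, (pn P + k)%:R^-1); split.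
  by exists P => //; exists k.
apply: W12; split => /=; last first.
  by apply: dW; rewrite /ball /= sub0r normrN ger0_norm ?invr_ge0.
apply: UV; split => /=; first exact: nbhs_singleton.
by apply: eV; rewrite /ball /= div1r sub0r normrN ger0_norm ?invr_ge0.
Qed.

Lemma contractible_Pinf : contractible R (Pinf R).
Proof.
exists antichain_limit; split; first exact: Pinf_antichain_limit.
(* The thinning factor runs from 1, the identity on proper limits, down to 0, while the inverse size
   stays 0. *)
exists (fun z => thin (z.1, 1 - z.2, 0)); split; [|split; [|split]].
- apply: continuous_subspaceT => z.
  apply: (@continuous_comp _ _ _ (fun z : ambient R * R => (z.1, 1 - z.2, 0)) thin);
    last exact: continuous_thin.
  apply: (@continuous_pair _ _ _ (fun z : ambient R * R => (z.1, 1 - z.2)) (fun=> 0 : R));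
    last by move=> ?; exact: cvg_cst.
  apply: continuous_pair => y; first exact: cvg_fst.
  by apply: cvgB; [exact: cvg_cst|exact: cvg_snd].
- move=> x s xP; rewrite /I01 /= in_itv /= => /andP[s0 s1].
  by apply: thin_Pinf => //; apply/andP; split; lra.
- by move=> x /Pinf_inv_size0 x0; rewrite /= subr0 thin1.
- by move=> x [xcl _]; rewrite /= subrr thin0.
Qed.

End poset_limits.

Theorem theorem11p1 (R : realType) :
  contractible R (Pinf R) /\ connected (Pinf R) /\ simply_connected R (Pinf R).
Proof.
have cP := contractible_Pinf R; split => //; split.
  exact: path_connected_connected _ (contractible_path_connected _ cP).
exact: contractible_simply_connected.
Qed.
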